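(* For a multi-hop network with unicast flows on fixed known paths, the age-difference policy is a myopic greedy policy for minimizing the average age $$\lim_{T\to\infty}\mathbb{E}\left[\frac1T\sum_{t=1}^{T}\sum_{k=1}^{K}\sum_{j\in C_k\cup D_k}w_j^kA_j^k(t)\right].$$ That is, writing $C(t)=\sum_{k=1}^{K}\sum_{j\in C_k\cup D_k}w_j^kA_j^k(t)$ for the per-slot cost, in every slot $t$ the action $m(t)\in\mathcal{A}$ chosen by the age-difference policy minimizes, over all actions in $\mathcal{A}$, the conditional expectation of the next-slot cost $C(t+1)$ given the information available to the scheduler at time $t$.
   Context: Network: a graph with slotted time and $K$ unicast flows. Flow $k$ has source node $k$, a single destination $d_k$ (so $D_k=\{d_k\}$), and a set $C_k$ of commissioned (forwarding) nodes such that $\{k\}\cup C_k\cup\{d_k\}$ forms a single known path from $k$ to $d_k$; updates of flow $k$ are sent along this path, from a node $i\in\{k\}\cup C_k$ to the next node $j\in C_k\cup D_k$. Channel: $S_{ij}(t)\in\{0,1\}$ is the state of link $(i,j)$, independent across links and i.i.d. over time, with $\gamma_{ij}=\mathbb{P}[S_{ij}(t)=1]$. Actions: $\mathcal{A}$ is the finite collection of feasible actions; each $m\in\mathcal{A}$ is a set of pairs $(e,k)$ (link, flow) that can be transmitted simultaneously without interference. $U_{ij}^k(t)=1$ if the action chosen at time $t$ transmits flow $k$ on link $(i,j)$ from $i$ to $j$, and $0$ otherwise. Ages: the source's age for its own flow is $A_k^k(t)=0$. For $j\in C_k\cup D_k$ with preceding node $i$ on the path of flow $k$, $$A_j^k(t+1)=\begin{cases}\min(A_j^k(t),A_i^k(t))+1&\text{if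 }U_{ij}^k(t)S_{ij}(t)=1,\\ A_j^k(t)+1&\text{if }U_{ij}^k(t)S_{ij}(t)=0.\end{cases}$$ Weights: for the destination $j\in D_k$, $w_j^k$ is a given constant weight; for every commissioned node $j\in C_k$, $w_j^k=1$. Age-difference policy: with $[x]^+=\max\{x,0\}$, define $$\Delta_{ij}^k(t)=w_j^kS_{ij}(t)\,[A_j^k(t)-A_i^k(t)]^+$$ if the channel states at time $t$ are known to the scheduler at time $t$; if they are unknown, $S_{ij}(t)$ is replaced by $\gamma_{ij}$. In each slot the policy selects $$m(t)\in\arg\max_{m\in\mathcal{A}}\sum_{(e,k)\in m}\Delta_e^k(t).$$ The information available at time $t$ consists of all ages and actions up to that time together with, in the known-state case, the channel states at time $t$. *)

(* Defs.v *)
(* MathComp-Analysis *)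
From HB Require Import structures.
From mathcomp Require Import all_boot all_order all_algebra.
From mathcomp Require Import all_classical all_reals all_analysis.

Set Implicit Arguments.
Unset Strict Implicit.
Unset Printing Implicit Defensive.

Import Order.TTheory GRing.Theory Num.Theory.

Local Open Scope classical_set_scope.
Local Open Scope ring_scope.

(* A link is an ordered pair (i, j), used from i to j.  An action is the set of
   (link, flow) pairs that it transmits. *)
Definition action (V : finType) (K : nat) : finType := {set (V * V) * 'I_K}.

Section Paths.
Variables (V : finType) (K : nat).
Variables (src dst : 'I_K -> V) (relays : 'I_K -> seq V).

(* [relays k] lists the commissioned nodes C_k in path order, so that the path
   of flow k is [src k :: route_of k], and C_k `|` D_k is the set of members of
   [route_of k]. *)
Definition route_of (k : 'I_K) : seq V := rcons (relays k) (dst k).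

(* For j in [route_of k], the node preceding j on the path of flow k. *)
Definition before_of (k : 'I_K) (j : V) : V :=
  nth (src k) (src k :: relays k) (index j (route_of k)).

End Paths.

Record network (R : realType) (V : finType) (K : nat) := Network {
  links : {set V * V};
  src : 'I_K -> V;
  dst : 'I_K -> V;
  relays : 'I_K -> seq V;
  dst_weight : 'I_K -> R;
  actions : {set action V K};
  src_inj : injective src;
  route_path : forall k,
    path (fun i j => (i, j) \in links) (src k) (route_of dst relays k);
  route_simple : forall k, uniq (src k :: route_of dst relays k);
  (* a flow is only ever transmitted along the hops of its own path *)
  actions_on_route : forall a p, a \in actions -> p \in a ->
    p.1.2 \in route_of dst relays p.2 /\
    p.1.1 = before_of src dst relays p.2 p.1.2
}.

Section Dynamics.
Variables (R : realType) (V : finType) (K : nat) (N : network R V K).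

Definition route (k : 'I_K) : seq V := route_of (dst N) (relays N) k.

Definition before (k : 'I_K) (j : V) : V :=
  before_of (src N) (dst N) (relays N) k j.

(* w_j^k, for j in [route k] *)
Definition weight (k : 'I_K) (j : V) : R :=
  if j == dst N k then dst_weight N k else 1.

(* Ages A_j^k.  They only matter at j = src k, where they are 0, and at j in
   [route k]; off the path of flow k they are set to 0 as well. *)
Definition ages : Type := 'I_K -> V -> R.

Definition start (A : ages) : ages :=
  fun k j => if j \in route k then A k j else 0.

(* ages in the next slot when action a is played under channel states s *)
Definition next_ages (a : action V K) (s : V * V -> bool) (A : ages) : ages :=
  fun k j =>
    if j \in route k then
      let i := before k j in
      if (((i, j), k) \in a) && s (i, j)
      then Num.min (A k j) (A k i) + 1
      else A k j + 1
    else 0.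

Definition cost (A : ages) : R :=
  \sum_(k < K) \sum_(j in route k) weight k j * A k j.

(* the sum over (e, k) in a of Delta_e^k, where [c e] is S_e or gamma_e *)
Definition total_gain (c : V * V -> R) (A : ages) (a : action V K) : R :=
  \sum_(p in a)
    weight p.2 p.1.2 * c p.1 * Num.max (A p.2 p.1.2 - A p.2 p.1.1) 0.

End Dynamics.

Section Probability.
Context d (T : measurableType d) (R : realType) (P : probability T R).

(* mutual independence of the classes of events G i, for i in D *)
Definition mutually_independent (I : choiceType) (D : set I)
    (G : I -> set (set T)) : Prop :=
  forall (s : seq I) (B : I -> set T),
    uniq s -> (forall i, i \in s -> D i /\ G i (B i)) ->
    P (\bigcap_(i in [set` s]) B i) = (\prod_(i <- s) P (B i))%E.

(* Z is a version of the conditional expectation E[X | G] *)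
Definition is_cond_exp (G : set (set T)) (X Z : T -> R) : Prop :=
  [/\ P.-integrable setT (EFin \o X),
      P.-integrable setT (EFin \o Z),
      forall Y : set R, measurable Y -> G (Z @^-1` Y)
    & forall B, G B ->
        (\int[P]_(x in B) (Z x)%:E = \int[P]_(x in B) (X x)%:E)%E].

End Probability.

Section Scheduling.
Context d (T : measurableType d) (R : realType) (P : probability T R).
Variables (V : finType) (K : nat) (N : network R V K).
(* [S e t] is the state of link e in slot t, [A0] the ages in the initial slot
   0, and [m t] the action played in slot t. *)
Variables (gamma : V * V -> R) (S : V * V -> nat -> T -> bool).
Variables (A0 : T -> ages R V K) (m : nat -> T -> action V K).
(* [exo] collects the randomness that is exogenous to the channel: initial ages
   and, for randomized schedulers, tie-breaking.  The trivial sigma-algebra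
   gives constant initial ages and nonrandomized schedulers. *)
Variable exo : set (set T).
(* whether the channel states of a slot are known when scheduling that slot *)
Variable known : bool.

Fixpoint age (t : nat) (x : T) : ages R V K :=
  if t is t'.+1 then next_ages N (m t' x) (fun e => S e t' x) (age t' x)
  else start N (A0 x).

Definition channel_model : Prop :=
  [/\ forall e t, e \in links N -> measurable_fun setT (S e t),
      forall e t, e \in links N -> P [set x | S e t x] = (gamma e)%:E,
      sigma_algebra setT exo /\ exo `<=` measurable
    & mutually_independent P
        [set o : option ((V * V) * nat) |
          if o is Some et then et.1 \in links N else true]
        (fun o => if o is Some et
                  then preimage_set_system setT (S et.1 et.2) setT
                  else exo)].

Definition initial_ages : Prop :=
  forall k j, j \in route N k ->
    (forall Y : set R, measurable Y -> exo ((fun x => A0 x k j) @^-1` Y)) /\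
    P.-integrable setT (EFin \o (fun x => A0 x k j)).

Inductive observed (t : nat) : set T -> Prop :=
| observed_age s k j (Y : set R) of (s <= t)%N & measurable Y :
    observed t ((fun x => age s x k j) @^-1` Y)
| observed_action s a of (s < t)%N :
    observed t [set x | m s x = a]
| observed_channel e of known & e \in links N :
    observed t [set x | S e t x].

(* the information available when the action of slot t is selected *)
Definition info (t : nat) : set (set T) := <<s observed t >>.

Definition nonanticipative : Prop :=
  forall t a, <<s exo `|` info t >> [set x | m t x = a].

Definition age_difference_policy : Prop :=
  forall t x,
    let c e := if known then (S e t x)%:R else gamma e in
    m t x \in actions N /\
    forall a, a \in actions N ->
      total_gain N c (age t x) a <= total_gain N c (age t x) (m t x).

(* cost in slot t.+1 when action a is played in slot t, after the actual past *)
Definition next_cost (t : nat) (a : action V K) (x : T) : R :=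
  cost N (next_ages N a (fun e => S e t x) (age t x)).

(* Z a is E[C(t+1) | info t] when the action of slot t is set to a, and the
   action actually played in slot t attains the minimum of Z over the feasible
   actions.  Conditional expectations are unique up to negligible sets and
   there are finitely many actions, so the choice of Z is immaterial. *)
Definition myopic_greedy : Prop :=
  forall t, exists Z : action V K -> T -> R,
    [/\ forall a, a \in actions N ->
          is_cond_exp P (info t) (next_cost t a) (Z a),
        is_cond_exp P (info t) (fun x => cost N (age t.+1 x))
          (fun x => Z (m t x) x)
      & {ae P, forall x, m t x \in actions N /\
          forall a, a \in actions N -> Z (m t x) x <= Z a x}].

End Scheduling.

(* Main.v *)
Require Import Defs.
From mathcomp Require Import all_boot all_order all_algebra.
From mathcomp Require Import all_classical all_reals all_analysis.
From mathcomp Require Import measurable_realfun ring.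

(* Playing action a in a slot changes the next cost from the cost of letting
   every age grow by one, which does not depend on a, by minus the sum over
   (e, k) in a of w S_e [A_j - A_i]^+.  Every state S_e of the current slot is
   either known, or independent of all that precedes, in which case conditioning
   replaces it by gamma_e; so the conditional expected next cost of a is a
   constant minus total_gain of a, and the policy maximizes the latter. *)

Set Implicit Arguments.
Unset Strict Implicit.
Unset Printing Implicit Defensive.

Import Order.TTheory GRing.Theory Num.Theory.

Local Open Scope classical_set_scope.
Local Open Scope ring_scope.

(** * Measurability of indicators, conditional sums and minima *)

Lemma measurable_natr_bool d (T : measurableType d) (R : realType)
    (b : T -> bool) :
  measurable [set x | b x] -> measurable_fun setT (fun x => (b x)%:R : R).
Proof.
move=> mb; rewrite (_ : (fun x => _) = \1_[set x | b x]).
  exact: measurable_indic.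
by apply/funext => x; rewrite indicE mem_setE.
Qed.

Lemma measurable_sum_cond d (T : measurableType d) (R : realType) (I : Type)
    (r : seq I) (Q : pred I) (h : I -> T -> R) :
  (forall i, Q i -> measurable_fun setT (h i)) ->
  measurable_fun setT (fun x => \sum_(i <- r | Q i) h i x).
Proof.
move=> mh; under eq_fun do rewrite big_mkcond.
apply: measurable_sum => i; case: (boolP (Q i)) => [/mh//|_].
exact: measurable_cst.
Qed.

(* M may break ties by exogenous randomness, hence need not be measurable here;
   the minimum that it attains is. *)
Lemma measurable_argmin d (T : measurableType d) (R : realType) (I : finType)
    (A : {set I}) (z : I -> T -> R) (M : T -> I) :
  (forall i, i \in A -> measurable_fun setT (z i)) ->
  (forall x, M x \in A) ->
  (forall x i, i \in A -> z (M x) x <= z i x) ->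
  measurable_fun setT (fun x => z (M x) x).
Proof.
move=> mz MA Mmin _ Y mY; rewrite setTI.
(* All minimizers at a point share one value, so the index [M x] can be replaced by any [i]
   satisfying the finitely many inequalities, and [M] disappears. *)
rewrite (_ : _ @^-1` _ = \bigcup_(i in [set i | i \in A])
    (z i @^-1` Y `&` \bigcap_(j in [set j | j \in A]) [set x | z i x <= z j x])).
  apply: fin_bigcup_measurable => // i iA; apply: measurableI.
    by rewrite -[X in measurable X]setTI; exact: (mz i iA measurableT Y mY).
  apply: fin_bigcap_measurable => // j jA; rewrite -[X in measurable X]setTI.
  by have := measurable_fun_ler (mz i iA) (mz j jA); apply.
apply/seteqP; split => [x Yx|x [i /= iA [Yx imin]]].
  by exists (M x); [exact: MA|split=> // j jA; exact: Mmin].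
suff -> : z (M x) x = z i x by [].
by apply/eqP; rewrite eq_le Mmin//=; exact: (imin (M x) (MA x)).
Qed.

(** * Closure properties of integrable functions *)

Section Integrable.
Context d (T : measurableType d) (R : realType) (P : {measure set T -> \bar R}).
Implicit Types f g : T -> R.

Lemma integrable_subr f g : P.-integrable setT (EFin \o f) ->
  P.-integrable setT (EFin \o g) ->
  P.-integrable setT (EFin \o (fun x => f x - g x)).
Proof.
by move=> fi gi; exact: eq_integrable (integrableB measurableT fi gi).
Qed.

Lemma integrable_maxr0 f : P.-integrable setT (EFin \o f) ->
  P.-integrable setT (EFin \o (fun x => Num.max (f x) 0)).
Proof.
move=> fi; apply: le_integrable (fi) => //.
  apply/measurable_EFinP/measurable_maxr; last exact: measurable_cst.
  by apply/measurable_EFinP; exact: measurable_int fi.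
move=> x _; rewrite /= lee_fin; case: (leP (f x) 0) => // _.
by rewrite normr0.
Qed.

Lemma integrable_bool_mul (b : T -> bool) f : measurable [set x | b x] ->
  P.-integrable setT (EFin \o f) ->
  P.-integrable setT (EFin \o (fun x => (b x)%:R * f x)).
Proof.
move=> mb fi; apply: le_integrable (fi) => //.
  apply/measurable_EFinP/measurable_funM; first exact: measurable_natr_bool.
  by apply/measurable_EFinP; exact: measurable_int fi.
move=> x _; rewrite /= lee_fin normrM ler_piMl//.
by case: (b x); rewrite ?normr1 ?normr0.
Qed.

End Integrable.

(** * From independent classes to independent generated sigma-algebras *)

Section Independence.
Context d (T : measurableType d) (R : realType) (P : probability T R).

(* pi-lambda argument on the finite intersections of members of the G j. *)
Lemma mutually_independent_g_sigma (I : choiceType) (D J : set I)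
    (G : I -> set (set T)) (i : I) (A B : set T) :
  mutually_independent P D G ->
  (forall j, D j -> G j `<=` measurable) ->
  (forall j, D j -> setI_closed (G j)) ->
  (forall j, D j -> G j setT) ->
  J `<=` D -> D i -> ~ J i ->
  <<s \bigcup_(j in J) G j >> A -> G i B -> P (A `&` B) = (P A * P B)%E.
Proof.
move=> ind Gm GI GT JD Di NJi sA GB.
have mB : measurable B by exact: Gm GB.
pose Pi := [set A : set T | exists s (C : I -> set T),
  [/\ uniq s, forall j, j \in s -> J j /\ G j (C j)
    & A = \bigcap_(j in [set` s]) C j]].
have Pim : Pi `<=` measurable.
  move=> _ [s [C [_ JC ->]]]; apply: fin_bigcap_measurable => //= j js.
  by have [/JD Dj] := JC _ js; exact: Gm.
have PiT : Pi setT.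
  by exists [::], (fun=> setT); split => //; rewrite set_nil bigcap_set0.
have PiI : setI_closed Pi.
  move=> _ _ [s [C [us JC ->]]] [s' [C' [us' JC' ->]]].
  (* The two families are merged over the union of their indices and padded with the whole space
     where an index is missing. *)
  exists (undup (s ++ s')), (fun j => (if j \in s then C j else setT) `&`
                                      (if j \in s' then C' j else setT)).
  split; first exact: undup_uniq.
  - move=> j; rewrite mem_undup mem_cat => jss.
    have Jj : J j by case/orP: jss => [/JC[]|/JC'[]].
    split => //; apply: (GI _ (JD _ Jj)).
      by case: ifPn => [/JC[]//|_]; exact/GT/JD.
    by case: ifPn => [/JC'[]//|_]; exact/GT/JD.
  - apply/seteqP; split => [x [Cx C'x] j /=|x CC'x].
      by move=> _; split; case: ifPn => // jin; [exact: Cx|exact: C'x].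
    split => j /= jin; have := CC'x j; rewrite /= mem_undup mem_cat jin ?orbT;
      by move=> /(_ isT)[].
have PB_ge0 : 0 <= fine (P B) by exact/fine_ge0.
have PBE : (fine (P B))%:E = P B by rewrite fineK// fin_num_measure.
pose m1 : {measure set T -> \bar R} := mrestr P mB.
pose m2 : {measure set T -> \bar R} := mscale (NngNum PB_ge0) P.
suff : m1 A = m2 A.
  by rewrite /m1/= /mrestr => ->; rewrite /m2/= /mscale/= PBE muleC.
apply: (g_sigma_algebra_measure_unique Pi Pim (fun=> setT)) => //.
- by rewrite bigcup_const.
- move=> _ [s [C [us JC ->]]]; rewrite /m1/m2/= /mrestr /mscale/= PBE.
  have is_ : i \notin s by apply/negP => /JC[].
  have -> : P (\bigcap_(j in [set` s]) C j) = (\prod_(j <- s) P (C j))%E.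
    by apply: ind => // j /JC[/JD].
  (* [B] joins the family at the index [i], which is fresh because [J] omits it, so independence
     applies to [i :: s]. *)
  pose CB j := if j == i then B else C j.
  have CBE j : j \in s -> CB j = C j.
    by rewrite /CB; case: eqVneq => // ->; rewrite (negbTE is_).
  have -> : \bigcap_(j in [set` s]) C j `&` B =
            \bigcap_(j in [set` i :: s]) CB j.
    apply/seteqP; split => [x [Cx Bx] j|x CBx].
      rewrite /= inE => /orP[/eqP->|js]; first by rewrite /CB eqxx.
      by rewrite CBE//; exact: Cx.
    split => [j /= js|].
      by rewrite -CBE//; apply: CBx; rewrite /= inE js orbT.
    by have := CBx i; rewrite /CB eqxx; apply; rewrite /= inE eqxx.
  rewrite ind /= ?is_ ?us//; last first.
    move=> j; rewrite inE => /orP[/eqP->|js]; first by rewrite /CB eqxx.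
    by rewrite CBE//; have [/JD] := JC _ js.
  rewrite big_cons {1}/CB eqxx; congr (_ * _)%E.
  by apply: eq_big_seq => j js; rewrite CBE.
- by move=> _; rewrite /m1 /= /mrestr setTI ltey_eq fin_num_measure.
- apply: sub_sigma_algebra2 sA => C [j Jj GC].
  exists [:: j], (fun=> C); split => //.
    by move=> k; rewrite inE => /eqP->.
  by rewrite bigcap_seq big_seq1.
Qed.
End Independence.

(** * Measurability and integration on a generated sub-sigma-algebra *)

(** Encoded through [g_sigma_algebraType], so that the closure lemmas for measurable functions apply
    unchanged to the sub-sigma-algebra. *)
Definition measurable_wrt d (T : measurableType d) d' (U : measurableType d')
    (F : set (set T)) (f : T -> U) : Prop :=
  @measurable_fun _ _ (g_sigma_algebraType F) _ setT f.

Lemma measurable_wrtS d (T : measurableType d) d' (U : measurableType d')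
    (F G : set (set T)) (f : T -> U) :
  <<s F >> `<=` <<s G >> -> measurable_wrt F f -> measurable_wrt G f.
Proof. by move=> FG mf _ Y mY; apply: FG; exact: (mf measurableT Y mY). Qed.

Section SubSigmaAlgebra.
Context d (T : measurableType d) (R : realType) (P : probability T R).
Variable F : set (set T).
Hypothesis Fm : <<s F >> `<=` measurable.

Lemma measurable_fun_g_sigma d' (U : measurableType d') (f : T -> U) :
  measurable_wrt F f ->
  measurable_fun setT f.
Proof.
move=> mf _ Y mY; rewrite setTI; apply: Fm.
by have := mf measurableT Y mY; rewrite setTI.
Qed.

(* On the sub-sigma-algebra, A |-> P (A `&` E) and P E * P are the same measure,
   so they give the same integrals. *)
Let ge0_integral_setI_indep (f : T -> \bar R) (B E : set T) :
  measurable_wrt F f ->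
  (forall x, 0 <= f x)%E ->
  measurable E -> (forall A, <<s F >> A -> P (A `&` E) = (P A * P E)%E) ->
  <<s F >> B ->
  (\int[P]_(x in B `&` E) f x = P E * \int[P]_(x in B) f x)%E.
Proof.
move=> mf f0 mE indE FB.
have mB := Fm FB.
have mfT := measurable_fun_g_sigma mf.
(* Pushing forward along the identity into the coarser space leaves the integrals unchanged, and
   there the two measures need to agree only on [<<s F>>]. *)
pose phi : T -> g_sigma_algebraType F := id.
have mphi : measurable_fun setT phi by move=> _ Y FY; rewrite setTI; exact: Fm.
pose PE : {measure set T -> \bar R} := mrestr P mE.
have PE_ge0 : 0 <= fine (P E) by exact: fine_ge0.
have PEE : (fine (P E))%:E = P E by rewrite fineK// fin_num_measure.
transitivity (\int[PE]_(x in B `&` E) f x)%E.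
  apply: eq_measure_integral => A mA ABE; rewrite /PE /= /mrestr setIidl//.
  by move=> x /ABE[].
transitivity (\int[PE]_(x in B) f x)%E.
  rewrite -[in LHS](setCK E) -setDE -ge0_negligible_integral//.
  - exact: measurableC.
  - exact: measurable_funTS.
  - by rewrite /PE /= /mrestr setICl measure0.
have FB' : measurable (B : set (g_sigma_algebraType F)) by [].
have mfB : measurable_fun (B : set (g_sigma_algebraType F)) f.
  exact: measurable_funTS.
have push (mu : {measure set T -> \bar R}) :=
  ge0_integral_pushforward mphi mu FB' mfB (fun x _ => f0 x).
rewrite -[LHS](push PE) -[in RHS](push P) -PEE.
rewrite -[RHS](ge0_integral_mscale _ FB' (NngNum PE_ge0) mfB)//.
apply: eq_measure_integral => A FA AB.
by rewrite /= /mscale /= PEE /pushforward /PE /= /mrestr indE// muleC.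
Qed.

(** Positive and negative parts are treated separately; integrability of [f] lets [P E] distribute
    over their difference. *)
Lemma integral_setI_indep (f : T -> \bar R) (B E : set T) :
  measurable_wrt F f ->
  P.-integrable setT f ->
  measurable E -> (forall A, <<s F >> A -> P (A `&` E) = (P A * P E)%E) ->
  <<s F >> B ->
  (\int[P]_(x in B `&` E) f x = P E * \int[P]_(x in B) f x)%E.
Proof.
move=> mf fi mE indE FB.
have fiB := integrableS measurableT (Fm FB) (@subsetT _ _) fi.
rewrite integralE [in RHS]integralE muleBr//.
- rewrite ge0_integral_setI_indep//; last exact: measurable_funepos.
  by rewrite ge0_integral_setI_indep//; exact: measurable_funeneg.
- exact: fin_num_measure.
- by apply: integrable_add_def => //; exact: Fm.
Qed.

End SubSigmaAlgebra.

(** * The integral identity of conditional expectation *)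

Section SameIntegrals.
Context d (T : measurableType d) (R : realType) (P : probability T R).
Implicit Types (F : set (set T)) (X Z f : T -> R) (b : T -> bool).

(** Measurability of [Z] is left out: the identity is proved on a history, while [Z] must be
    measurable for the information, which that history contains. *)
Definition same_integrals F X Z : Prop :=
  [/\ P.-integrable setT (EFin \o X), P.-integrable setT (EFin \o Z)
    & forall B, F B -> (\int[P]_(x in B) (X x)%:E = \int[P]_(x in B) (Z x)%:E)%E].

Lemma same_integrals_refl F X :
  P.-integrable setT (EFin \o X) -> same_integrals F X X.
Proof. by []. Qed.

(** The coefficient lets one statement serve both differences, with -1, and sums, with 1. *)
Lemma same_integrals_linear F X Z X' Z' (a : R) : F `<=` measurable ->
  same_integrals F X Z -> same_integrals F X' Z' ->
  same_integrals F (fun x => X x + a * X' x) (fun x => Z x + a * Z' x).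
Proof.
move=> Fm [iX iZ XZ] [iX' iZ' XZ'].
have iD (Y Y' : T -> R) : P.-integrable setT (EFin \o Y) ->
    P.-integrable setT (EFin \o Y') ->
    P.-integrable setT (EFin \o (fun x => Y x + a * Y' x)).
  by move=> iY iY'; exact: eq_integrable (integrableD _ iY (integrableZl _ a iY')).
split; [exact: iD|exact: iD|] => B FB.
have intD (Y Y' : T -> R) : P.-integrable setT (EFin \o Y) ->
    P.-integrable setT (EFin \o Y') ->
    (\int[P]_(x in B) (Y x + a * Y' x)%:E =
     \int[P]_(x in B) (Y x)%:E + a%:E * \int[P]_(x in B) (Y' x)%:E)%E.
  move=> iY iY'; have mB := Fm _ FB.
  have iYB := integrableS measurableT mB (@subsetT _ _) iY.
  have iYB' := integrableS measurableT mB (@subsetT _ _) iY'.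
  by rewrite -integralZl// -integralD//; exact: integrableZl.
by rewrite !intD// XZ// XZ'.
Qed.

Lemma same_integralsB F X Z X' Z' : F `<=` measurable ->
  same_integrals F X Z -> same_integrals F X' Z' ->
  same_integrals F (X \- X') (Z \- Z').
Proof.
move=> Fm XZ XZ'; have := same_integrals_linear (-1) Fm XZ XZ'.
have e (Y Y' : T -> R) : (fun x => Y x + -1 * Y' x) = Y \- Y'.
  by apply/funext => x; rewrite mulN1r.
by rewrite !e.
Qed.

Lemma same_integrals_sum F (I : Type) (r : seq I) (Q : pred I)
    (X Z : I -> T -> R) : F `<=` measurable ->
  (forall i, Q i -> same_integrals F (X i) (Z i)) ->
  same_integrals F (fun x => \sum_(i <- r | Q i) X i x)
                   (fun x => \sum_(i <- r | Q i) Z i x).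
Proof.
move=> Fm XZ; elim: r => [|i r IH].
  have e (Y : I -> T -> R) :
      (fun x => \sum_(i <- [::] | Q i) Y i x) = (fun=> 0).
    by apply/funext => x; rewrite big_nil.
  by rewrite !e; apply: same_integrals_refl; exact: integrable0.
have e (Y : I -> T -> R) : (fun x => \sum_(i <- i :: r | Q i) Y i x) =
    if Q i then fun x => Y i x + 1 * \sum_(i <- r | Q i) Y i x
    else fun x => \sum_(i <- r | Q i) Y i x.
  by case: ifPn => Qi; apply/funext => x; rewrite big_cons ?Qi ?(negbTE Qi) ?mul1r.
rewrite !e; case: ifPn => // Qi.
exact: same_integrals_linear (XZ i Qi) IH.
Qed.

(** Over [B], the left side integrates [f] on the intersection of [B] with the event [b];
    independence turns this into [p] times the integral of [f] over [B]. *)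
Lemma same_integrals_indep F b f (p : R) : <<s F >> `<=` measurable ->
  measurable_wrt F f -> P.-integrable setT (EFin \o f) ->
  measurable [set x | b x] -> P [set x | b x] = p%:E ->
  (forall A, <<s F >> A ->
     P (A `&` [set x | b x]) = (P A * P [set x | b x])%E) ->
  same_integrals <<s F >> (fun x => (b x)%:R * f x) (fun x => p * f x).
Proof.
move=> Fm mf fi mb Pb indb; split.
- exact: integrable_bool_mul.
- exact: eq_integrable (integrableZl _ p fi).
move=> B FB; under [RHS]eq_integral do rewrite EFinM.
have fiB := integrableS measurableT (Fm _ FB) (@subsetT _ _) fi.
rewrite (integralZl (Fm _ FB) fiB).
rewrite -Pb -(integral_setI_indep Fm _ fi mb indb FB); last first.
  by apply/measurable_EFinP.
rewrite integral_mkcondr; apply: eq_integral => x _.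
have xb : (x \in [set x | b x]) = b x by apply/idP/idP; rewrite inE.
by rewrite patchE xb; case: (b x); rewrite ?mul1r ?mul0r.
Qed.

End SameIntegrals.

(** * The next cost as grown cost minus gain *)

Section Hops.
Context (R : realType) (V : finType) (K : nat) (N : network R V K).
Implicit Types (a : action V K) (A : ages R V K) (k : 'I_K) (j : V).

(** On a feasible action, [hop] inverts the map from a pair to its flow and receiving node, because
    the path determines the sender. *)
Definition hop k j : (V * V) * 'I_K := ((before N k j, j), k).

(** The predecessor of [j] has the same position in [src N k :: relays N k] as [j] in [route N k],
    so the path condition at that index yields the link. *)
Lemma hop_link k j : j \in route N k -> (before N k j, j) \in links N.
Proof.
move=> jk; have := route_path N k; rewrite -/(route N k).
move/(pathP (src N k))/(_ (index j (route N k))); rewrite index_mem => /(_ jk).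
rewrite nth_index// /route /route_of -rcons_cons nth_rcons.
suff -> : (index j (rcons (relays N k) (dst N k)) <
           size (src N k :: relays N k))%N by [].
by rewrite /= -(size_rcons (relays N k) (dst N k)) index_mem.
Qed.

Lemma action_hop a (p : (V * V) * 'I_K) : a \in actions N -> p \in a ->
  p.1.2 \in route N p.2 /\ p = hop p.2 p.1.2.
Proof.
move=> aN pa; have [jk ij] := actions_on_route aN pa.
by split => //; case: p ij {pa jk} => [[i j] k] /= ->.
Qed.

(** Rests on min(x, y) + 1 = x + 1 - [x - y]^+, which makes the effect of a delivery additive. *)
Lemma next_agesE a (s : V * V -> bool) A k j :
  next_ages N a s A k j =
  if j \in route N k then
    A k j + 1 - ((hop k j \in a) && s (hop k j).1)%:R *
                Num.max (A k j - A k (before N k j)) 0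
  else 0.
Proof.
rewrite /next_ages; case: ifPn => // _; case: ifPn => _; last by rewrite mul0r subr0.
rewrite mul1r; have [le_ij|/ltW le_ji] := leP (A k j) (A k (before N k j)).
  by rewrite (max_idPr _) ?subr0// subr_le0.
by rewrite (max_idPl _) ?subr_ge0//; ring.
Qed.

Definition aged_cost A : R :=
  \sum_(k < K) \sum_(j in route N k) weight N k j * (A k j + 1).

Lemma cost_next_ages a (s : V * V -> bool) A : a \in actions N ->
  cost N (next_ages N a s A) =
  aged_cost A - total_gain N (fun e => (s e)%:R) A a.
Proof.
move=> aN; pose g k j := weight N k j * (s (hop k j).1)%:R *
  Num.max (A k j - A k (before N k j)) 0.
have -> : total_gain N (fun e => (s e)%:R) A a =
    \sum_(k < K) \sum_(j in route N k) (hop k j \in a)%:R * g k j.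
  (* The sum over pairs becomes a sum over flows and receiving nodes; every pair of a feasible
     action is a hop, so no term is lost. *)
  rewrite /total_gain (reindex_onto (fun q => hop q.1 q.2)
    (fun p => (p.2, p.1.2))); last by move=> p /(action_hop aN)[].
  rewrite pair_big_dep big_mkcond [RHS]big_mkcond /=; apply: eq_bigr => -[k j] _ /=.
  rewrite eqxx andbT; case: (boolP (hop k j \in a)) => [ha|_].
    by have [/= -> _] := action_hop aN ha; rewrite mul1r.
  by rewrite mul0r; case: ifP.
rewrite /cost /aged_cost -sumrB; apply: eq_bigr => k _.
rewrite -sumrB; apply: eq_bigr => j jk; rewrite next_agesE jk /g -mulnb natrM.
ring.
Qed.

End Hops.

(** * Histories: what ages, actions and information depend on *)

Section Histories.
Context d (T : measurableType d) (R : realType) (P : probability T R).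
Variables (V : finType) (K : nat) (N : network R V K).
Variables (gamma : V * V -> R) (S : V * V -> nat -> T -> bool).
Variables (A0 : T -> ages R V K) (m : nat -> T -> action V K).
Variables (exo : set (set T)) (known : bool).
Hypothesis channel : channel_model P N gamma S exo.
Hypothesis init : initial_ages P N A0 exo.
Hypothesis nonant : nonanticipative N S A0 m exo known.

(** Restates the indexed family of [channel_model], so that its independence clause applies
    directly. *)
Let source (o : option ((V * V) * nat)) : set (set T) :=
  if o is Some et then preimage_set_system setT (S et.1 et.2) setT else exo.

Let is_source : set (option ((V * V) * nat)) :=
  [set o | if o is Some et then et.1 \in links N else true].

Let past (t : nat) : set (option ((V * V) * nat)) :=
  [set o | if o is Some et then et.1 \in links N /\ (et.2 < t)%N else True].

(* The action of slot t may depend only on <<s history (t + known) >>: a known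
   channel state of slot t counts as past. *)
Definition history (t : nat) : set (set T) := \bigcup_(o in past t) source o.

Let source_sigma o : is_source o ->
  sigma_algebra setT (source o) /\ source o `<=` measurable.
Proof.
have [mS _ [sexo mexo] _] := channel.
case: o => [[e t]|] //= eN; split.
  by apply: sigma_algebra_preimage; split.
move=> _ [Y _ <-]; exact: mS.
Qed.

Let past_source t : past t `<=` is_source.
Proof. by move=> [et []|]. Qed.

Lemma history_measurable t : <<s history t >> `<=` measurable.
Proof.
apply: smallest_sub; first exact: sigma_algebra_measurable.
by move=> A [i /past_source/source_sigma[_ mo] oA]; exact: mo.
Qed.

Lemma history_le s t : (s <= t)%N -> <<s history s >> `<=` <<s history t >>.
Proof.
move=> st; apply: sub_sigma_algebra2 => A [i so oA]; exists i => //.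
by case: i so {oA} => // et [eN es]; split => //; exact: leq_trans st.
Qed.

Lemma history_exo t : exo `<=` <<s history t >>.
Proof. by move=> A eA; apply: sub_sigma_algebra; exists None. Qed.

Lemma history_channel e s t : e \in links N -> (s < t)%N ->
  <<s history t >> [set x | S e s x].
Proof.
move=> eN st; apply: sub_sigma_algebra; exists (Some (e, s)) => //.
by exists [set true] => //; rewrite setTI.
Qed.

(** Only slots before [t] enter [history t], so the index of [S e t] lies outside [past t]; each
    source is a sigma-algebra, hence closed under intersection and containing the whole space. *)
Lemma history_indep e t A : e \in links N -> <<s history t >> A ->
  P (A `&` [set x | S e t x]) = (P A * P [set x | S e t x])%E.
Proof.
move=> eN HA; have [_ _ _ ind] := channel.
apply: (mutually_independent_g_sigma (i := Some (e, t)) (J := past t) ind) => //.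
- by move=> o /source_sigma[].
- move=> o /source_sigma[so _] B C oB oC.
  rewrite -[G in G (B `&` C)](sigma_algebra_id so).
  by apply: (@measurableI _ (g_sigma_algebraType (source o)));
    exact: sub_sigma_algebra.
- move=> o /source_sigma[[s0 sD _] _]; by move: (sD _ s0); rewrite setD0.
- by move=> [_ /=]; rewrite ltnn.
- by exists [set true] => //; rewrite setTI.
Qed.

(** The facts on ages and actions are hypotheses because this is invoked inside the induction that
    establishes them. *)
Lemma info_history t :
  (forall s, (s <= t)%N -> forall k j,
     measurable_wrt (history s) (fun x => age N S A0 m s x k j)) ->
  (forall s, (s < t)%N -> forall a,
     <<s history (s + known) >> [set x | m s x = a]) ->
  info N S A0 m known t `<=` <<s history (t + known) >>.
Proof.
move=> mage mact; apply: smallest_sub; first exact: smallest_sigma_algebra.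
move=> _ [s k j Y st mY|s a st|e -> eN].
- apply: (history_le (leq_trans st (leq_addr known t))).
  by have := mage s st k j measurableT Y mY; rewrite setTI.
- by apply: (history_le _ (mact s st a)); rewrite leq_add2r ltnW.
- by apply: history_channel => //; rewrite addn1.
Qed.

Lemma action_history t : info N S A0 m known t `<=` <<s history (t + known) >> ->
  forall a, <<s history (t + known) >> [set x | m t x = a].
Proof.
move=> infoH a; apply: smallest_sub (@nonant t a); first exact: smallest_sigma_algebra.
by move=> A [/history_exo|/infoH].
Qed.

Lemma hop_history t (M : T -> action V K) p :
  (forall a, <<s history t >> [set x | M x = a]) ->
  <<s history t >> [set x | p \in M x].
Proof.
move=> mM.
rewrite (_ : [set x | _] =
  \bigcup_(a in [set a : action V K | p \in a]) [set x | M x = a]).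
  apply: (@fin_bigcup_measurable _ (g_sigma_algebraType (history t))) => //.
  by move=> a _; exact: mM.
by apply/seteqP; split => [x pM|x [a /= pa ->]//]; exists (M x).
Qed.

Lemma transmission_history t k j :
  (forall a, <<s history (t + known) >> [set x | m t x = a]) ->
  j \in route N k ->
  <<s history t.+1 >> [set x | (hop N k j \in m t x) && S (hop N k j).1 t x].
Proof.
move=> mact jk; rewrite (_ : [set x | _] =
    [set x | hop N k j \in m t x] `&` [set x | S (hop N k j).1 t x]).
  apply: (@measurableI _ (g_sigma_algebraType (history t.+1))).
    apply: hop_history => a; apply: history_le (mact a).
    (* Known or not, [t + known] is at most [t.+1]. *)
    by case: known => /=; rewrite ?addn0 ?addn1.
  by apply: history_channel => //; exact: hop_link.
by apply/seteqP; split => x /andP.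
Qed.

Lemma age_history_step t :
  (forall k j, measurable_wrt (history t) (fun x => age N S A0 m t x k j)) ->
  (forall a, <<s history (t + known) >> [set x | m t x = a]) ->
  forall k j, measurable_wrt (history t.+1) (fun x => age N S A0 m t.+1 x k j).
Proof.
move=> mage mact k j; rewrite /=; under eq_fun do rewrite next_agesE.
case: (boolP (j \in route N k)) => jk; last exact: measurable_cst.
have mA j' := measurable_wrtS (history_le (leqnSn t)) (mage k j').
apply: measurable_funB.
  by apply: measurable_funD; [exact: mA|exact: measurable_cst].
apply: measurable_funM; last first.
  apply: measurable_maxr; last exact: measurable_cst.
  by apply: measurable_funB; exact: mA.
apply: measurable_natr_bool.
exact: transmission_history.
Qed.

(** Ages depend on earlier actions, and actions on information built from ages, so both are proved
    in one induction over slots. *)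
Lemma age_action_history t :
  (forall s, (s <= t)%N -> forall k j,
     measurable_wrt (history s) (fun x => age N S A0 m s x k j)) /\
  (forall s, (s < t)%N -> forall a,
     <<s history (s + known) >> [set x | m s x = a]).
Proof.
elim: t => [|t [mage mact]].
  split=> // s; rewrite leqn0 => /eqP-> k j; rewrite /= /start.
  case: (boolP (j \in route N k)) => jk; last exact: measurable_cst.
  move=> _ Y mY; rewrite setTI; apply: history_exo.
  by have [+ _] := init jk; apply.
have mact' s (st : (s < t.+1)%N) a :
    <<s history (s + known) >> [set x | m s x = a].
  move: st; rewrite ltnS leq_eqVlt => /predU1P[->|st]; last exact: mact.
  (* The information of slot [t] involves ages up to [t] but actions only before [t], so the
     argument is not circular. *)
  by apply: action_history; exact: info_history.
split=> // s; rewrite leq_eqVlt => /predU1P[->|st]; last exact: mage.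
by apply: age_history_step; [exact: mage|exact: mact'].
Qed.

(** A slot adds a constant to an age and subtracts an indicator times a positive part of an age
    difference; these operations preserve integrability. *)
Lemma integrable_age t k j :
  P.-integrable setT (EFin \o (fun x => age N S A0 m t x k j)).
Proof.
elim: t k j => [|t IH] k j; rewrite /= /start.
  case: (boolP (j \in route N k)) => jk; last exact: integrable0.
  by have [_] := init jk.
under eq_fun do rewrite next_agesE.
case: (boolP (j \in route N k)) => jk; last exact: integrable0.
have [_ mact] := age_action_history t.+1.
apply: integrable_subr; last apply: integrable_bool_mul.
- have i1 : P.-integrable setT (EFin \o cst 1).
    exact: finite_measure_integrable_cst.
  exact: eq_integrable (integrableD measurableT (IH k j) i1).
- apply: (@history_measurable t.+1); apply: transmission_history => // a.
  exact: mact.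
- exact: integrable_maxr0 (integrable_subr (IH k j) (IH k _)).
Qed.

End Histories.

(** * Conditional expectation of the next cost *)

Section Greedy.
Context d (T : measurableType d) (R : realType) (P : probability T R).
Variables (V : finType) (K : nat) (N : network R V K).
Variables (gamma : V * V -> R) (S : V * V -> nat -> T -> bool).
Variables (A0 : T -> ages R V K) (m : nat -> T -> action V K).
Variables (exo : set (set T)) (known : bool) (t : nat).
Hypothesis channel : channel_model P N gamma S exo.
Hypothesis init : initial_ages P N A0 exo.
Hypothesis nonant : nonanticipative N S A0 m exo known.

Let H := history N S exo (t + known).
Let A x := age N S A0 m t x.

Let mA k j : measurable_wrt H (fun x => A x k j).
Proof.
have [mage _] := age_action_history init nonant t.
exact: measurable_wrtS (history_le (leq_addr _ _)) (mage t (leqnn t) k j).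
Qed.

Let iA k j : P.-integrable setT (EFin \o (fun x => A x k j)).
Proof. exact: integrable_age channel init nonant _ _ _. Qed.

(** The channel factor is split off, so that the rest depends on the history alone; the membership
    indicator allows a fixed index set even for a random action. *)
Definition link_gain (B : ages R V K) (a : action V K)
    (p : (V * V) * 'I_K) : R :=
  (p \in a)%:R * (weight N p.2 p.1.2 * Num.max (B p.2 p.1.2 - B p.2 p.1.1) 0).

Lemma total_gain_links (c : V * V -> R) (B : ages R V K) (a : action V K) :
  a \in actions N ->
  total_gain N c B a = \sum_(p | p.1 \in links N) c p.1 * link_gain B a p.
Proof.
move=> aN; rewrite /total_gain big_mkcond [RHS]big_mkcond.
apply: eq_bigr => p _; rewrite /link_gain; case: (boolP (p \in a)) => [pa|_].
  have [jk ->] := action_hop aN pa; rewrite hop_link//= mul1r.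
  by rewrite mulrCA mulrA.
by rewrite mul0r mulr0; case: ifP.
Qed.

Lemma integrable_aged_cost :
  P.-integrable setT (EFin \o (fun x => aged_cost N (A x))).
Proof.
have iS (I : finType) (Q : pred I) (f : I -> T -> R) :
    (forall i, Q i -> P.-integrable setT (EFin \o f i)) ->
    P.-integrable setT (EFin \o (fun x => \sum_(i | Q i) f i x)).
  move=> fi; apply: eq_integrable (integrable_sum measurableT (index_enum I) fi) => //.
  by move=> x _ /=; rewrite sumEFin.
apply: (iS) => k _; apply: iS => j _.
have i1 : P.-integrable setT (EFin \o cst 1).
  exact: finite_measure_integrable_cst.
have iD := integrableD measurableT (iA k j) i1.
exact: eq_integrable (integrableZl measurableT (weight N k j) iD).
Qed.

Definition channel_estimate (x : T) (e : V * V) : R :=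
  if known then (S e t x)%:R else gamma e.

Definition predicted_cost (a : action V K) (x : T) : R :=
  aged_cost N (A x) - total_gain N (channel_estimate x) (A x) a.

(* M may use the randomness of exo, on which info t says nothing. *)
Lemma same_integrals_next_cost (M : T -> action V K) :
  (forall a, <<s H >> [set x | M x = a]) -> (forall x, M x \in actions N) ->
  same_integrals P <<s H >> (fun x => next_cost N S A0 m t (M x) x)
                            (fun x => predicted_cost (M x) x).
Proof.
move=> mM MN.
have Hm : <<s H >> `<=` measurable by exact: (history_measurable channel).
rewrite (_ : (fun x => next_cost _ _ _ _ _ _ _) =
  (fun x => aged_cost N (A x)) \- (fun x => \sum_(p | p.1 \in links N)
    (S p.1 t x)%:R * link_gain (A x) (M x) p)); last first.
  by apply/funext => x; rewrite /next_cost cost_next_ages ?total_gain_links.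
rewrite (_ : (fun x => predicted_cost _ _) =
  (fun x => aged_cost N (A x)) \- (fun x => \sum_(p | p.1 \in links N)
    channel_estimate x p.1 * link_gain (A x) (M x) p)); last first.
  by apply/funext => x; rewrite /predicted_cost total_gain_links.
apply: same_integralsB => //.
  exact/same_integrals_refl/integrable_aged_cost.
apply: same_integrals_sum => // p pN.
have mp : <<s H >> [set x | p \in M x] by exact: hop_history.
have ig : P.-integrable setT (EFin \o (fun x => link_gain (A x) (M x) p)).
  apply: integrable_bool_mul; first exact: Hm.
  have imax := integrable_maxr0 (integrable_subr (iA p.2 p.1.2) (iA p.2 p.1.1)).
  exact: eq_integrable (integrableZl measurableT (weight N p.2 p.1.2) imax).
have [mS Sgamma _ _] := channel.
have mSe : measurable [set x | S p.1 t x].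
  by rewrite -[X in measurable X]setTI; exact: (mS p.1 t pN measurableT [set true]).
(* In the known case the estimate is the state itself and both sides coincide. Otherwise the history
   stops before slot [t], so the state is independent of it and averages to [gamma]. *)
rewrite /channel_estimate; move: @H mA Hm mp; case: known => /=.
  by move=> *; apply: same_integrals_refl; exact: integrable_bool_mul.
rewrite addn0 => mAt Hm' mp'; apply: same_integrals_indep => //.
- apply: measurable_funM; first exact: measurable_natr_bool.
  apply: measurable_funM; first exact: measurable_cst.
  apply: measurable_maxr; last exact: measurable_cst.
  by apply: measurable_funB; exact: mAt.
- exact: Sgamma.
- by move=> B; exact: (history_indep channel pN).
Qed.

(** For a fixed action only observed quantities enter. The action played may also depend on [exo],
    and is handled by [measurable_argmin]. *)
Lemma info_predicted_cost (a : action V K) : a \in actions N ->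
  measurable_wrt (observed N S A0 m known t) (predicted_cost a).
Proof.
move=> aN.
have mAi k j : measurable_wrt (observed N S A0 m known t) (fun x => A x k j).
  by move=> _ Y mY; rewrite setTI; apply: sub_sigma_algebra; exact: observed_age.
apply: measurable_funB.
  apply: measurable_sum_cond => k _; apply: measurable_sum_cond => j _.
  apply: measurable_funM; first exact: measurable_cst.
  by apply: measurable_funD; [exact: mAi|exact: measurable_cst].
apply: measurable_sum_cond => p pa; apply: measurable_funM.
  apply: measurable_funM; first exact: measurable_cst.
  rewrite /channel_estimate; case: known; last exact: measurable_cst.
  apply: measurable_natr_bool; apply: sub_sigma_algebra.
  apply: observed_channel => //.
  by have [jk ->] := action_hop aN pa; exact: hop_link.
apply: measurable_maxr; last exact: measurable_cst.
by apply: measurable_funB; exact: mAi.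
Qed.

End Greedy.

Theorem lemma3 (d : measure_display) (T : measurableType d) (R : realType)
    (P : probability T R) (V : finType) (K : nat) (N : network R V K)
    (gamma : V * V -> R) (S : V * V -> nat -> T -> bool)
    (A0 : T -> ages R V K) (m : nat -> T -> action V K)
    (exo : set (set T)) (known : bool) :
  channel_model P N gamma S exo ->
  initial_ages P N A0 exo ->
  nonanticipative N S A0 m exo known ->
  age_difference_policy N gamma S A0 m known ->
  myopic_greedy P N S A0 m known.
Proof.
move=> channel init nonant policy t.
pose Z := predicted_cost N gamma S A0 m known t.
have mN x : m t x \in actions N by have [] := policy t x.
have Zmin x a : a \in actions N -> Z (m t x) x <= Z a x.
  by move=> aN; have [_ gain] := policy t x; rewrite lerD2l lerN2; exact: gain.
have [mage mact] := age_action_history init nonant t.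
have infoH := info_history mage mact.
(* [M] covers both a fixed action and the action played. The integral identity restricts from the
   history to [info], whereas measurability must be supplied for the observations themselves. *)
have condE (M : T -> action V K) :
    (forall a, <<s history N S exo (t + known) >> [set x | M x = a]) ->
    (forall x, M x \in actions N) ->
    measurable_wrt (observed N S A0 m known t) (fun x => Z (M x) x) ->
    is_cond_exp P (info N S A0 m known t)
      (fun x => next_cost N S A0 m t (M x) x) (fun x => Z (M x) x).
  move=> mM MN mZ.
  have [iX iZ XZ] := same_integrals_next_cost channel init nonant mM MN.
  split=> // [Y mY|B /infoH HB]; last exact/esym/XZ.
  by have := mZ measurableT Y mY; rewrite setTI.
have mZ a : a \in actions N ->
  measurable_wrt (observed N S A0 m known t) (Z a) by exact: info_predicted_cost.
exists Z; split.
- move=> a aN; apply: (condE (fun=> a)) => // [b|]; last exact: mZ.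
  (* A constant action generates only the whole space and the empty event. *)
  have [->|ab] := eqVneq a b.
    rewrite (_ : [set _ | _] = setT); last exact/seteqP.
    exact: (@measurableT _ (g_sigma_algebraType (history N S exo (t + known)))).
  rewrite (_ : [set _ | _] = set0); first exact: sigma_algebra0.
  by apply/seteqP; split => // x /= /eqP; rewrite (negbTE ab).
(* By computation, the cost of [age t.+1] is [next_cost] at the action played. *)
- apply: (condE (m t)) => //; first exact: action_history.
  exact: (measurable_argmin mZ mN Zmin).
- by apply: aeW => x; split => // a; exact: Zmin.
Qed.
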